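(* (Place-locality, Resilient TX10) If $\langle s,g\rangle$ is a place-local resilient configuration and $\langle s,g\rangle\xrightarrow{\lambda}_p\langle s',g'\rangle$ (respectively $\langle s,g\rangle\xrightarrow{\lambda}_p g'$) in Resilient TX10, then $\langle s',g'\rangle$ is a place-local resilient configuration (respectively $g'$ is a place-local heap).
   Context: **Syntax.** $\mathsf{Pl}=\{0,\dots,n-1\}$ is a finite set of places (ranged over by $p,q$). $\mathsf{ObjId}$ is an infinite set of object ids with a fixed bijection with $\mathbb N$ (the enumeration order); $\mathsf p:\mathsf{ObjId}\to\mathsf{Pl}$ gives the home place; $\mathsf{ObjId}_q=\{o:\mathsf p(o)=q\}$; global references are $\mathsf{grObjId}=\{o\$p : o\in\mathsf{ObjId}_p\}$. Values $v$: object ids $o$, global references $o\$p$, exception constants $\mathsf E,\mathsf{BF},\mathsf{BG},\mathsf{DP}$. Expressions: $e::= v\mid x\mid e.f\mid\{f_1{:}e_1,\dots,f_n{:}e_n\}\mid \mathtt{globalref}\ e\mid\mathtt{valof}\ e$. Statements: $s,t::=\mathtt{skip}\mid\mathtt{throw}\ v$ ($v$ an exception constant) $\mid \mathtt{val}\ x=e\ s\mid e.f=e'\mid\{s\ t\}\mid\mathtt{at}(p)(\mathtt{val}\ x=e)\,s\mid\mathtt{async}\ s\mid\mathtt{finish}\ s\mid\mathtt{try}\ s\ \mathtt{catch}\ t$, plus the dynamic (runtime only) statements $\overline{\mathtt{at}}(p)\,s\mid\overline{\mathtt{async}}\,s\mid\mathtt{finish}_\mu\,s$ with $\mu$ a finite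 set of exception values; $\mathtt{finish}\ s$ abbreviates $\mathtt{finish}_\emptyset\,s$. In $\mathtt{val}\ x=e\ s$ and $\mathtt{at}(p)(\mathtt{val}\ x=e)s$ the only free variable of $s$ is $x$. **Heaps.** A local heap $h$ is a finite partial map from object ids to objects, an object being a finite partial map from field names to values. A global heap $g$ is a partial map from $\mathsf{Pl}$ to local heaps; $\mathrm{dom}(g)$ is the set of non-failed places. $f[a\mapsto b]$ denotes map update. For $o\in\mathrm{dom}(h)$, $h_o$ is the set of object ids (local or global) reachable from $o$ in $h$ via fields. $g$ is place-local if for every $q\in\mathrm{dom}(g)$, with $h=g(q)$: $\mathrm{dom}(h)\subseteq\mathsf{ObjId}_q$ and $h_o\subseteq(\mathsf{ObjId}_q\cap\mathrm{dom}(h))\cup\mathsf{grObjId}$ for all $o\in\mathrm{dom}(h)$. A resilient configuration $\langle s,g\rangle$ with $g$ place-local is place-local if for all $q\in\mathrm{dom}(g)$ every local object id $o$ occurring in $s$ under $\mathtt{at}(q)$ or $\overline{\mathtt{at}}(q)$ (innermost enclosing) satisfies $o\in\mathrm{dom}(g(q))$; ids occurring under no such construct are regarded as occurring at the executing place $p$, and in $\mathtt{at}(q)(\mathtt{val}\ x=e)s'$ the expression $e$ is not under $\mathtt{at}(q)$. **Predicates.** $\mathsf{isAsync}(\overline{\mathtt{async}}\,s)$; $\mathsf{isAsync}(s)$ implies $\mathsf{isAsync}(\overline{\mathtt{at}}(p)s)$ and $\mathsf{isAsync}(\mathtt{try}\,s\,\mathtt{catch}\,t)$; $\mathsf{isAsync}(s)$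 and $\mathsf{isAsync}(t)$ imply $\mathsf{isAsync}(\{s\ t\})$. $\mathsf{isSync}$ holds of $\mathtt{skip}$, $\mathtt{val}\ x=e\ s$, $e.f=e'$, $\mathtt{at}(p)(\mathtt{val}\ x=e)s$, $\mathtt{async}\ s$, $\mathtt{finish}_\mu\,s$, $\mathtt{throw}\ v$; and $\mathsf{isSync}(s)$ implies $\mathsf{isSync}$ of $\{s\ t\}$, $\{t\ s\}$, $\overline{\mathtt{at}}(p)s$, $\mathtt{try}\,s\,\mathtt{catch}\,t$. **Transitions.** Configurations are $\langle s,g\rangle$ or $g$ (terminated). Labels $\lambda$: $\epsilon$ (normal), $v\otimes$ (synchronous exception), $v\times$ (asynchronous exception). $\to_p$ means $\xrightarrow{\epsilon}_p$. In rules, ''$A\mid B$'' in premise and conclusion denotes two rules, matching first with first and second with second. *Expressions* (at place $p$, local heap $h$): $\langle\{f_1{:}v_1,\dots,f_n{:}v_n\},h\rangle\to_p\langle o,h[o\mapsto\{f_i\mapsto v_i\}]\rangle$ with $o\in\mathsf{ObjId}_p\setminus\mathrm{dom}(h)$; $\langle o.f,h\rangle\to_p\langle v,h\rangle$ if $h(o)(f)=v$; $\langle o.f,h\rangle\xrightarrow{\mathsf{BF}\otimes}_p h$ if $f\notin\mathrm{dom}(h(o))$; $\langle\mathtt{globalref}\ o,h\rangle\to_p\langle o\$p,h\rangle$; $\langle\mathtt{valof}\ o\$p,h\rangle\to_p\langle o,h\rangle$; $\langle\mathtt{valof}\ v,h\rangle\xrightarrow{\mathsf{BG}\otimes}_p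 h$ if $v$ is not of the form $o\$p$; and if $\langle e,h\rangle\xrightarrow{\lambda}_p\langle e',h'\rangle\mid h$ then the same label is taken in the contexts $[\,].f$, $\mathtt{globalref}\,[\,]$, $\mathtt{valof}\,[\,]$, $\{f_1{:}v_1,\dots,f_i{:}v_i,f_{i+1}{:}[\,],\dots\}$ (leading to $h$ in the exceptional case). *Basic statements* (all require $p\in\mathrm{dom}(g)$): $\langle\mathtt{skip},g\rangle\to_p g$; $\langle\mathtt{throw}\ v,g\rangle\xrightarrow{v\otimes}_p g$; if $\langle s[v/x],g\rangle\xrightarrow{\lambda}_p\langle s',g'\rangle\mid g'$ then $\langle\mathtt{val}\ x=v\ s,g\rangle\xrightarrow{\lambda}_p\langle s',g'\rangle\mid g'$; $\langle o.f=v,g\rangle\to_p g[p\mapsto g(p)[o\mapsto g(p)(o)[f\mapsto v]]]$ if $f\in\mathrm{dom}(g(p)(o))$; $\langle o.f=v,g\rangle\xrightarrow{\mathsf{BF}\otimes}_p g$ if $f\notin\mathrm{dom}(g(p)(o))$; (Ctx) if $\langle e,g(p)\rangle\xrightarrow{\lambda}_p\langle e',h'\rangle\mid h'$ and $g'=g[p\mapsto h']$ then $\mathtt{val}\ x=e\ s$, $e.f=e_1$, $o.f=e$, $\mathtt{at}(q)(\mathtt{val}\ x=e)s$ in heap $g$ make a $\lambda$-step at $p$ to the same statement with $e'$ for $e$ in heap $g'$, resp. to $g'$. *Copy.* For $o\in\mathsf{ObjId}$ and $q\in\mathrm{dom}(g)$, $\mathsf{copy}(o,q,g)=(o',g[q\mapsto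 h'])$ where $h'$ extends $h=g(q)$ by a fresh isomorphic copy, rooted at $o'$, of the object graph reachable from $o$ in $g(\mathsf p(o))$; the new ids are the next unused elements of $\mathsf{ObjId}_q$ and global references are preserved unchanged. For other values $\mathsf{copy}(v,q,g)=(v,g)$. *Remaining Resilient TX10 rules:* (Place Failure) for $p\in\mathrm{dom}(g)$, $p\neq0$: $\langle s,g\rangle\to_p\langle s,g\setminus\{(p,g(p))\}\rangle$. (Local Failure) if $p\notin\mathrm{dom}(g)$, each of $\mathtt{skip}$, $\mathtt{throw}\ v$, $\mathtt{val}\ x=e\ s$, $e_1.f=e_2$ in heap $g$ makes a step $\xrightarrow{\mathsf{DP}\otimes}_p g$. (Spawn) $\langle\mathtt{async}\ s,g\rangle\to_p\langle\overline{\mathtt{async}}\,s,g\rangle$ if $p\in\mathrm{dom}(g)$; $\langle\mathtt{async}\ s,g\rangle\xrightarrow{\mathsf{DP}\otimes}_p g$ if $p\notin\mathrm{dom}(g)$. (Async) if $\langle s,g\rangle\xrightarrow{\lambda}_p\langle s',g'\rangle\mid g'$ then $\langle\overline{\mathtt{async}}\,s,g\rangle\xrightarrow{\lambda'}_p\langle\overline{\mathtt{async}}\,s',g'\rangle\mid g'$, with $\lambda'=\epsilon$ if $\lambda=\epsilon$ and $\lambda'=v\times$ if $\lambda\in\{v\times,v\otimes\}$. (Finish) if $\langle s,g\rangle\xrightarrow{\lambda}_p\langle s',g'\rangle$ then $\langle\mathtt{finish}_\mu s,g\rangle\to_p\langle\mathtt{finish}_{\mu\cup\lambda}s',g'\rangle$,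 where $\mu\cup\epsilon=\mu$ and $\mu\cup v\times=\mu\cup v\otimes=\mu\cup\{v\}$. (End of Finish) if $\langle s,g\rangle\xrightarrow{\lambda}_p g'$ then $\langle\mathtt{finish}_\mu s,g\rangle\xrightarrow{\lambda'}_p g'$ with $\lambda'=\epsilon$ if $\mu\cup\lambda=\emptyset$; otherwise $\lambda'=\mathsf E\otimes$ if $p\in\mathrm{dom}(g)$ and $\lambda'=\mathsf{DP}\otimes$ if $p\notin\mathrm{dom}(g)$. (Seq) if $\langle s,g\rangle\xrightarrow{\lambda}_p\langle s',g'\rangle$: $\langle\{s\ t\},g\rangle\xrightarrow{\lambda}_p\langle\{s'\ t\},g'\rangle$ if $\lambda\in\{\epsilon,v\times\}$, and $\langle\{s\ t\},g\rangle\xrightarrow{\lambda}_p\langle s',g'\rangle$ if $\lambda=v\otimes$. (Par) if $\mathsf{isAsync}(t)$ and $\langle s,g\rangle\xrightarrow{\lambda}_p\langle s',g'\rangle\mid g'$ then $\langle\{t\ s\},g\rangle\xrightarrow{\lambda}_p\langle\{t\ s'\},g'\rangle\mid\langle t,g'\rangle$. (Seq Term) if $p\in\mathrm{dom}(g)$ and $\langle s,g\rangle\xrightarrow{\lambda}_p g'$: $\langle\{s\ t\},g\rangle\xrightarrow{\lambda}_p\langle t,g'\rangle$ if $\lambda\in\{\epsilon,v\times\}$, and $\langle\{s\ t\},g\rangle\xrightarrow{\lambda}_p g'$ if $\lambda=v\otimes$. (Seq Failed Term) if $p\notin\mathrm{dom}(g)$ and $\langle s,g\rangle\xrightarrow{\lambda}_p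 g'$: $\langle\{s\ t\},g\rangle\xrightarrow{\mathsf{DP}\otimes}_p g'$ if $\mathsf{isSync}(s)$, and $\langle\{s\ t\},g\rangle\xrightarrow{\mathsf{DP}\times}_p\langle t,g'\rangle$ if $\mathsf{isAsync}(s)$. (Place Shift) if $p,q\in\mathrm{dom}(g)$ and $(v',g')=\mathsf{copy}(v,q,g)$, $\langle\mathtt{at}(q)(\mathtt{val}\ x=v)s,g\rangle\to_p\langle\overline{\mathtt{at}}(q)\{s[v'/x]\ \mathtt{skip}\},g'\rangle$; if $q\notin\mathrm{dom}(g)$ or $p\notin\mathrm{dom}(g)$, $\langle\mathtt{at}(q)(\mathtt{val}\ x=e)s,g\rangle\xrightarrow{\mathsf{DP}\otimes}_p g$. (At) if $\langle s,g\rangle\xrightarrow{\lambda}_q\langle s',g'\rangle\mid g'$ then $\langle\overline{\mathtt{at}}(q)s,g\rangle\xrightarrow{\lambda'}_p\langle\overline{\mathtt{at}}(q)s',g'\rangle\mid g'$, where $\lambda'=\mathsf{DP}\otimes$ if $\lambda=v\otimes$ and $p\notin\mathrm{dom}(g)$, and $\lambda'=\lambda$ otherwise. (Try) if $\langle s,g\rangle\xrightarrow{\lambda}_p\langle s',g'\rangle\mid g'$: if $\lambda\in\{\epsilon,v\times\}$, $\langle\mathtt{try}\,s\,\mathtt{catch}\,t,g\rangle\xrightarrow{\lambda}_p\langle\mathtt{try}\,s'\,\mathtt{catch}\,t,g'\rangle\mid g'$; if $p\in\mathrm{dom}(g)$, $\lambda=v\otimes$, $\langle\mathtt{try}\,s\,\mathtt{catch}\,t,g\rangle\to_p\langle\{s'\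 t\},g'\rangle\mid\langle t,g'\rangle$; if $p\notin\mathrm{dom}(g)$, $\lambda=\mathsf{DP}\otimes$, $\langle\mathtt{try}\,s\,\mathtt{catch}\,t,g\rangle\xrightarrow{\lambda}_p\langle s',g'\rangle\mid g'$.
   Formalization: Adds, and proves preserved, that no global reference dangles: if o$q occurs in s or in a field of g and q has not failed, then o is in dom(g(q)). Without this, val x = valof o$p skip with o not in dom(g(p)) steps to a configuration that is not place-local. *)

(* Defs.v *)
From HB Require Import structures.
From mathcomp Require Import all_boot finmap.

Set Implicit Arguments.
Unset Strict Implicit.
Unset Printing Implicit Defensive.

Local Open Scope fset_scope.
Local Open Scope fmap_scope.

(* ObjId is identified with nat along its fixed bijection with the natural
   numbers, so that the enumeration order is the order of nat. *)
Definition objid := nat.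

Inductive exn := exnE | exnBF | exnBG | exnDP.

Definition exn_code (c : exn) : bool * bool :=
  match c with
  | exnE => (false, false) | exnBF => (false, true)
  | exnBG => (true, false) | exnDP => (true, true)
  end.
Definition exn_decode (b : bool * bool) : exn :=
  match b with
  | (false, false) => exnE | (false, true) => exnBF
  | (true, false) => exnBG | (true, true) => exnDP
  end.
Lemma exn_codeK : cancel exn_code exn_decode. Proof. by case. Qed.
HB.instance Definition _ := Finite.copy exn (can_type exn_codeK).

Inductive label :=
| Eps
| Sync of exn   (* v (x) : synchronous exception *)
| Async of exn. (* v x   : asynchronous exception *)

Definition is_sync_label (l : label) : bool := if l is Sync _ then true else false.

Definition async_label (l : label) : label :=
  match l with Eps => Eps | Sync v => Async v | Async v => Async v end.

Definition add_label (mu : {set exn}) (l : label) : {set exn} :=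
  match l with Eps => mu | Sync v | Async v => v |: mu end.

Section ResilientTX10.

Variables (n : nat) (home : objid -> 'I_n) (fname : choiceType) (var : eqType).

Notation place := 'I_n.

Definition grObjId : pred (objid * place) := [pred r | home r.1 == r.2].

(* The global references o$p, i.e. the pairs (o, p) with p = home o. *)
Definition gref := {r : objid * place | r \in grObjId}.

Inductive value := VLoc of objid | VGlob of gref | VExn of exn.

Definition value_code (v : value) : objid + (gref + exn) :=
  match v with
  | VLoc o => inl o | VGlob r => inr (inl r) | VExn c => inr (inr c)
  end.
Definition value_decode (c : objid + (gref + exn)) : value :=
  match c with
  | inl o => VLoc o | inr (inl r) => VGlob r | inr (inr c) => VExn c
  end.
Lemma value_codeK : cancel value_code value_decode. Proof. by case. Qed.
HB.instance Definition _ := Equality.copy value (can_type value_codeK).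

Definition isGlobAt (p : place) (v : value) : bool :=
  if v is VGlob r then (val r).2 == p else false.

Inductive expr :=
| EVal of value
| EVar of var
| EField of expr & fname
| EObj of seq (fname * expr)
| EGlobalref of expr
| EValof of expr.

(* The suffix D marks the dynamic counterparts (overlined in print) of at and
   async. [finish s] is [SFinish set0 s]. *)
Inductive stmt :=
| SSkip
| SThrow of exn
| SVal (x : var) (e : expr) (s : stmt)
| SAssign (e : expr) (f : fname) (e' : expr)
| SSeq (s t : stmt)
| SAt (q : place) (x : var) (e : expr) (s : stmt)
| SAsync (s : stmt)
| SFinish (mu : {set exn}) (s : stmt)
| STry (s t : stmt)
| SAtD (q : place) (s : stmt)
| SAsyncD (s : stmt).

Fixpoint esubst (x : var) (v : value) (e : expr) : expr :=
  match e with
  | EVal w => EVal w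
  | EVar y => if y == x then EVal v else EVar y
  | EField e1 f => EField (esubst x v e1) f
  | EObj fes => EObj [seq (fe.1, esubst x v fe.2) | fe <- fes]
  | EGlobalref e1 => EGlobalref (esubst x v e1)
  | EValof e1 => EValof (esubst x v e1)
  end.

Fixpoint subst (x : var) (v : value) (s : stmt) : stmt :=
  match s with
  | SSkip => SSkip
  | SThrow c => SThrow c
  | SVal y e s1 =>
      SVal y (esubst x v e) (if y == x then s1 else subst x v s1)
  | SAssign e f e' => SAssign (esubst x v e) f (esubst x v e')
  | SSeq s1 s2 => SSeq (subst x v s1) (subst x v s2)
  | SAt q y e s1 =>
      SAt q y (esubst x v e) (if y == x then s1 else subst x v s1)
  | SAsync s1 => SAsync (subst x v s1)
  | SFinish mu s1 => SFinish mu (subst x v s1)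
  | STry s1 s2 => STry (subst x v s1) (subst x v s2)
  | SAtD q s1 => SAtD q (subst x v s1)
  | SAsyncD s1 => SAsyncD (subst x v s1)
  end.

Fixpoint efv (e : expr) : seq var :=
  match e with
  | EVal _ => [::]
  | EVar y => [:: y]
  | EField e1 _ | EGlobalref e1 | EValof e1 => efv e1
  | EObj fes => flatten [seq efv fe.2 | fe <- fes]
  end.

Fixpoint fv (s : stmt) : seq var :=
  match s with
  | SSkip | SThrow _ => [::]
  | SVal x e s1 | SAt _ x e s1 => efv e ++ [seq y <- fv s1 | y != x]
  | SAssign e _ e' => efv e ++ efv e'
  | SSeq s1 s2 | STry s1 s2 => fv s1 ++ fv s2
  | SAsync s1 | SFinish _ s1 | SAtD _ s1 | SAsyncD s1 => fv s1
  end.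

Fixpoint static (s : stmt) : bool :=
  match s with
  | SSkip | SThrow _ | SAssign _ _ _ => true
  | SVal _ _ s1 | SAt _ _ _ s1 | SAsync s1 => static s1
  | SSeq s1 s2 | STry s1 s2 => static s1 && static s2
  | SFinish mu s1 => (mu == set0) && static s1
  | SAtD _ _ | SAsyncD _ => false
  end.

(* The syntactic conventions on binders: the body of [val x = e s] and of
   [at(q)(val x = e) s] has no free variable other than x; and, dynamic
   statements being created by execution only, they do not occur in such a
   body, which has not started to execute. *)
Fixpoint wf_stmt (s : stmt) : bool :=
  match s with
  | SSkip | SThrow _ | SAssign _ _ _ => true
  | SVal x _ s1 | SAt _ x _ s1 =>
      [&& all (pred1 x) (fv s1), static s1 & wf_stmt s1]
  | SSeq s1 s2 | STry s1 s2 => wf_stmt s1 && wf_stmt s2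
  | SAsync s1 | SFinish _ s1 | SAtD _ s1 | SAsyncD s1 => wf_stmt s1
  end.

(* [occ p s] lists the values occurring in s, each with the place of its
   innermost enclosing at, or p if there is none. *)
Fixpoint eocc (e : expr) : seq value :=
  match e with
  | EVal v => [:: v]
  | EVar _ => [::]
  | EField e1 _ | EGlobalref e1 | EValof e1 => eocc e1
  | EObj fes => flatten [seq eocc fe.2 | fe <- fes]
  end.

Fixpoint occ (p : place) (s : stmt) : seq (place * value) :=
  match s with
  | SSkip => [::]
  | SThrow c => [:: (p, VExn c)]
  | SVal _ e s1 => [seq (p, v) | v <- eocc e] ++ occ p s1
  | SAssign e _ e' => [seq (p, v) | v <- eocc e ++ eocc e']
  | SSeq s1 s2 | STry s1 s2 => occ p s1 ++ occ p s2
  | SAt q _ e s1 => [seq (p, v) | v <- eocc e] ++ occ q s1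
  | SAtD q s1 => occ q s1
  | SAsync s1 | SFinish _ s1 | SAsyncD s1 => occ p s1
  end.

Definition obj := {fmap fname -> value}.
Definition lheap := {fmap objid -> obj}.
Definition gheap := {fmap place -> lheap}.

(* [reach h o v]: v is reachable from o in h via fields. The set h_o of the
   text consists of the local and global ids v such that [reach h o v]. *)
Inductive reach (h : lheap) (o : objid) : value -> Prop :=
| reach_root : reach h o (VLoc o)
| reach_field o1 (ob : obj) f v :
    reach h o (VLoc o1) -> h.[? o1] = Some ob -> ob.[? f] = Some v ->
    reach h o v.

Definition heap_place_local (g : gheap) : Prop :=
  forall q (h : lheap), g.[? q] = Some h ->
    (forall o, o \in domf h -> home o = q) /\
    (forall o v, o \in domf h -> reach h o v ->
       match v with
       | VLoc o' => home o' = q /\ o' \in domf h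
       | VGlob r => val r \in grObjId
       | VExn _ => True
       end).

Definition place_local (p : place) (s : stmt) (g : gheap) : Prop :=
  heap_place_local g /\
  (forall q (h : lheap) o, g.[? q] = Some h -> (q, VLoc o) \in occ p s -> o \in domf h).

(* No global reference in use dangles: if o$q occurs in s, or in a field of an
   object of g, and q has not failed, then o is allocated at q. Without this,
   [valof o$q] could produce a local id outside the heap of q. *)
Definition gref_resolved (g : gheap) (r : gref) : Prop :=
  forall h : lheap, g.[? (val r).2] = Some h -> (val r).1 \in domf h.

Definition grefs_resolved (p : place) (s : stmt) (g : gheap) : Prop :=
  (forall q r, (q, VGlob r) \in occ p s -> gref_resolved g r) /\
  (forall q (h : lheap) o (ob : obj) f r,
     g.[? q] = Some h -> h.[? o] = Some ob -> ob.[? f] = Some (VGlob r) ->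
     gref_resolved g r).

Fixpoint isAsync (s : stmt) : bool :=
  match s with
  | SAsyncD _ => true
  | SAtD _ s1 => isAsync s1
  | STry s1 _ => isAsync s1
  | SSeq s1 s2 => isAsync s1 && isAsync s2
  | _ => false
  end.

Fixpoint isSync (s : stmt) : bool :=
  match s with
  | SSkip | SVal _ _ _ | SAssign _ _ _ | SAt _ _ _ _ | SAsync _
  | SFinish _ _ | SThrow _ => true
  | SSeq s1 s2 => isSync s1 || isSync s2
  | SAtD _ s1 => isSync s1
  | STry s1 _ => isSync s1
  | SAsyncD _ => false
  end.

(* Field names in a literal are meant to be distinct (the leftmost wins). *)
Definition mkobj (fvs : seq (fname * value)) : obj :=
  foldr (fun fv (m : obj) => m.[fv.1 <- fv.2]) [fmap] fvs.

Inductive econf := ERun of expr & lheap | EDone of lheap.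

Definition map_econf (K : expr -> expr) (c : econf) : econf :=
  match c with ERun e h => ERun (K e) h | EDone h => EDone h end.

Inductive estep (p : place) : expr -> lheap -> label -> econf -> Prop :=
| ES_new fvs (h : lheap) o :
    home o = p -> o \notin domf h ->
    estep p (EObj [seq (fv.1, EVal fv.2) | fv <- fvs]) h
      Eps (ERun (EVal (VLoc o)) h.[o <- mkobj fvs])
| ES_select o (ob : obj) f v (h : lheap) :
    h.[? o] = Some ob -> ob.[? f] = Some v ->
    estep p (EField (EVal (VLoc o)) f) h Eps (ERun (EVal v) h)
| ES_select_bad o (ob : obj) f (h : lheap) :
    h.[? o] = Some ob -> f \notin domf ob ->
    estep p (EField (EVal (VLoc o)) f) h (Sync exnBF) (EDone h)
| ES_globalref o r h :
    val r = (o, p) ->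
    estep p (EGlobalref (EVal (VLoc o))) h Eps (ERun (EVal (VGlob r)) h)
| ES_valof o r h :
    val r = (o, p) ->
    estep p (EValof (EVal (VGlob r))) h Eps (ERun (EVal (VLoc o)) h)
| ES_valof_bad v h :
    ~~ isGlobAt p v ->
    estep p (EValof (EVal v)) h (Sync exnBG) (EDone h)
| ES_field_ctx e f h l c :
    estep p e h l c ->
    estep p (EField e f) h l (map_econf (EField^~ f) c)
| ES_globalref_ctx e h l c :
    estep p e h l c -> estep p (EGlobalref e) h l (map_econf EGlobalref c)
| ES_valof_ctx e h l c :
    estep p e h l c -> estep p (EValof e) h l (map_econf EValof c)
| ES_obj_ctx fvs f e fes h l c :
    estep p e h l c ->
    let K e' := EObj ([seq (fv.1, EVal fv.2) | fv <- fvs] ++ (f, e') :: fes) in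
    estep p (K e) h l (map_econf K c).

Definition copy_value (phi : objid -> objid) (v : value) : value :=
  if v is VLoc o then VLoc (phi o) else v.

Definition copy_obj (phi : objid -> objid) (ob : obj) : obj :=
  [fmap f : domf ob => copy_value phi (ob f)].

(* [copy q g v v' g']: (v', g') = copy(v, q, g). The renaming phi sends the ids
   reachable from o bijectively to the first unused ids of place q. Which
   reachable id gets which of these is left unspecified, so copy is a relation. *)
Inductive copy (q : place) (g : gheap) : value -> value -> gheap -> Prop :=
| copy_loc o (h0 h h' : lheap) (phi : objid -> objid) :
    g.[? home o] = Some h0 ->
    g.[? q] = Some h ->
    let R r := reach h0 o (VLoc r) in
    (forall r1 r2, R r1 -> R r2 -> phi r1 = phi r2 -> r1 = r2) ->
    (forall r, R r -> home (phi r) = q /\ phi r \notin domf h) ->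
    (forall r i, R r -> i < phi r -> home i = q -> i \notin domf h ->
       exists2 r', R r' & phi r' = i) ->
    (forall r, R r -> h'.[? phi r] = omap (copy_obj phi) h0.[? r]) ->
    (forall i, (forall r, R r -> phi r <> i) -> h'.[? i] = h.[? i]) ->
    copy q g (VLoc o) (VLoc (phi o)) g.[q <- h']
| copy_glob r : copy q g (VGlob r) (VGlob r) g
| copy_exn c : copy q g (VExn c) (VExn c) g.

Inductive conf := Run of stmt & gheap | Done of gheap.

Definition map_conf (K : stmt -> stmt) (c : conf) : conf :=
  match c with Run s g => Run (K s) g | Done g => Done g end.

Definition map_conf_then (K : stmt -> stmt) (t : stmt) (c : conf) : conf :=
  match c with Run s g => Run (K s) g | Done g => Run t g end.

(* The result of a context step at p from that of the expression. *)
Definition lift_econf (K : expr -> stmt) (p : place) (g : gheap) (c : econf) :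
    conf :=
  match c with
  | ERun e h => Run (K e) g.[p <- h]
  | EDone h => Done g.[p <- h]
  end.

Inductive ctx : (expr -> stmt) -> Prop :=
| ctx_val x s : ctx (fun e => SVal x e s)
| ctx_assign_l f e1 : ctx (fun e => SAssign e f e1)
| ctx_assign_r o f : ctx (fun e => SAssign (EVal (VLoc o)) f e)
| ctx_at q x s : ctx (fun e => SAt q x e s).

Definition fails_locally (s : stmt) : bool :=
  match s with
  | SSkip | SThrow _ | SVal _ _ _ | SAssign _ _ _ => true
  | _ => false
  end.

Inductive step : place -> stmt -> gheap -> label -> conf -> Prop :=
| S_skip p (g : gheap) :
    p \in domf g -> step p SSkip g Eps (Done g)
| S_throw p c (g : gheap) :
    p \in domf g -> step p (SThrow c) g (Sync c) (Done g)
| S_val p x v s (g : gheap) l c :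
    p \in domf g ->
    step p (subst x v s) g l c ->
    step p (SVal x (EVal v) s) g l c
| S_assign p o f v (g : gheap) (h : lheap) (ob : obj) :
    g.[? p] = Some h -> h.[? o] = Some ob -> f \in domf ob ->
    step p (SAssign (EVal (VLoc o)) f (EVal v)) g
      Eps (Done g.[p <- h.[o <- ob.[f <- v]]])
| S_assign_bad p o f v (g : gheap) (h : lheap) (ob : obj) :
    g.[? p] = Some h -> h.[? o] = Some ob -> f \notin domf ob ->
    step p (SAssign (EVal (VLoc o)) f (EVal v)) g (Sync exnBF) (Done g)
| S_ctx p K e (g : gheap) (h : lheap) l c :
    ctx K -> g.[? p] = Some h -> estep p e h l c ->
    step p (K e) g l (lift_econf K p g c)
| S_place_failure p s (g : gheap) :
    p \in domf g -> val p != 0 ->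
    step p s g Eps (Run s g.[~ p])
| S_local_failure p s (g : gheap) :
    p \notin domf g -> fails_locally s ->
    step p s g (Sync exnDP) (Done g)
| S_spawn p s (g : gheap) :
    p \in domf g -> step p (SAsync s) g Eps (Run (SAsyncD s) g)
| S_spawn_failed p s (g : gheap) :
    p \notin domf g -> step p (SAsync s) g (Sync exnDP) (Done g)
| S_async p s (g : gheap) l c :
    step p s g l c ->
    step p (SAsyncD s) g (async_label l) (map_conf SAsyncD c)
| S_finish p mu s (g : gheap) l s' g' :
    step p s g l (Run s' g') ->
    step p (SFinish mu s) g Eps (Run (SFinish (add_label mu l) s') g')
| S_finish_end p mu s (g : gheap) l g' :
    step p s g l (Done g') ->
    step p (SFinish mu s) g
      (if add_label mu l == set0 then Eps
       else if p \in domf g then Sync exnE else Sync exnDP)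
      (Done g')
| S_seq p s t (g : gheap) l s' g' :
    step p s g l (Run s' g') -> ~~ is_sync_label l ->
    step p (SSeq s t) g l (Run (SSeq s' t) g')
| S_seq_exn p s t (g : gheap) v s' g' :
    step p s g (Sync v) (Run s' g') ->
    step p (SSeq s t) g (Sync v) (Run s' g')
| S_par p s t (g : gheap) l c :
    isAsync t -> step p s g l c ->
    step p (SSeq t s) g l (map_conf_then (SSeq t) t c)
| S_seq_term p s t (g : gheap) l g' :
    p \in domf g -> step p s g l (Done g') -> ~~ is_sync_label l ->
    step p (SSeq s t) g l (Run t g')
| S_seq_term_exn p s t (g : gheap) v g' :
    p \in domf g -> step p s g (Sync v) (Done g') ->
    step p (SSeq s t) g (Sync v) (Done g')
| S_seq_failed_sync p s t (g : gheap) l g' :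
    p \notin domf g -> step p s g l (Done g') -> isSync s ->
    step p (SSeq s t) g (Sync exnDP) (Done g')
| S_seq_failed_async p s t (g : gheap) l g' :
    p \notin domf g -> step p s g l (Done g') -> isAsync s ->
    step p (SSeq s t) g (Async exnDP) (Run t g')
| S_shift p q x v s (g : gheap) v' g' :
    p \in domf g -> q \in domf g -> copy q g v v' g' ->
    step p (SAt q x (EVal v) s) g
      Eps (Run (SAtD q (SSeq (subst x v' s) SSkip)) g')
| S_shift_failed p q x e s (g : gheap) :
    (q \notin domf g) || (p \notin domf g) ->
    step p (SAt q x e s) g (Sync exnDP) (Done g)
| S_at p q s (g : gheap) l c :
    step q s g l c ->
    step p (SAtD q s) g
      (if is_sync_label l && (p \notin domf g) then Sync exnDP else l)
      (map_conf (SAtD q) c)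
| S_try p s t (g : gheap) l c :
    step p s g l c -> ~~ is_sync_label l ->
    step p (STry s t) g l (map_conf (STry^~ t) c)
| S_try_catch p s t (g : gheap) v c :
    p \in domf g -> step p s g (Sync v) c ->
    step p (STry s t) g Eps (map_conf_then (SSeq^~ t) t c)
| S_try_failed p s t (g : gheap) c :
    p \notin domf g -> step p s g (Sync exnDP) c ->
    step p (STry s t) g (Sync exnDP) c.

End ResilientTX10.

(* Main.v *)
(* Place-locality together with the absence of dangling global references
   amounts to a condition on single values: a value at place q is good if, q
   (respectively its home place) not having failed, its id is allocated there.
   Goodness persists along every step, since a step only removes places and
   enlarges the surviving local heaps; so it suffices to check the values that
   a step creates. A substituted value never moves to another place, because
   the bodies of binders are closed and contain no dynamic at. *)
Require Import Defs.
From mathcomp Require Import all_boot finmap.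
From Stdlib Require Import Classical_Prop.

Set Implicit Arguments.
Unset Strict Implicit.
Unset Printing Implicit Defensive.

Local Open Scope fset_scope.
Local Open Scope fmap_scope.

Section PlaceLocality.

Variables (n : nat) (home : objid -> 'I_n) (fname : choiceType) (var : eqType).

Notation place := 'I_n.
Notation value := (value home).
Notation expr := (expr home fname var).
Notation stmt := (stmt home fname var).
Notation obj := (obj home fname).
Notation lheap := (lheap home fname).
Notation gheap := (gheap home fname).

Implicit Types (p q : place) (e : expr) (s t : stmt) (v : value).
Implicit Types (h : lheap) (g : gheap) (x : var).

(* The generated principle gives no hypothesis on the fields of a literal. *)
Lemma expr_nested_ind (P : expr -> Prop) :
  (forall v, P (EVal fname var v)) ->
  (forall x, P (EVar home fname x)) ->
  (forall e f, P e -> P (EField e f)) ->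
  (forall fes, foldr (fun fe Q => P fe.2 /\ Q) True fes -> P (EObj fes)) ->
  (forall e, P e -> P (EGlobalref e)) ->
  (forall e, P e -> P (EValof e)) ->
  forall e, P e.
Proof.
move=> Pval Pvar Pfield Pobj Pglob Pvalof.
fix IH 1 => -[v|x|e f|fes|e|e].
- exact: Pval.
- exact: Pvar.
- exact: Pfield.
- by apply: Pobj; elim: fes => [|[f1 e1] fes IHfes] //=; split.
- exact: Pglob.
- exact: Pvalof.
Qed.

(** * Substitution and the values occurring in a term *)

Lemma esubst_id x v e : x \notin efv e -> esubst x v e = e.
Proof.
elim/expr_nested_ind: e => //= [y|e f IH|fes IH|e IH|e IH].
- by rewrite inE eq_sym => /negPf->.
- by move=> /IH->.
- move=> xN; congr EObj.
  elim: fes IH xN => //= -[f e] fes IHfes /= [IHe IH]; rewrite mem_cat negb_or.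
  by case/andP=> /IHe -> /(IHfes IH) ->.
- by move=> /IH->.
- by move=> /IH->.
Qed.

Lemma subst_id x v s : x \notin fv s -> subst x v s = s.
Proof.
elim: s => //= [y e s IH|e f e'|s IHs t IHt|q y e s IH|s IH|mu s IH|s IHs t IHt|q s IH|s IH];
  rewrite ?mem_cat ?negb_or ?mem_filter.
- case/andP=> /esubst_id -> xs; congr SVal.
  by case: eqVneq xs => //= _ /IH->.
- by case/andP=> /esubst_id -> /esubst_id ->.
- by case/andP=> /IHs -> /IHt ->.
- case/andP=> /esubst_id -> xs; congr SAt.
  by case: eqVneq xs => //= _ /IH->.
- by move=> /IH->.
- by move=> /IH->.
- by case/andP=> /IHs -> /IHt ->.
- by move=> /IH->.
- by move=> /IH->.
Qed.

(** A body has no free variable but the bound one. Hence substitution never reaches the body of an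
    [SAt], which belongs to another place. *)
Lemma subst_under_binder x v y s :
  all (pred1 y) (fv s) -> (if y == x then s else subst x v s) = s.
Proof.
move=> /allP fvs; case: eqVneq => // yx; apply: subst_id.
by apply: contraNN yx => /fvs /=; rewrite eq_sym.
Qed.

Lemma wf_subst x v s : wf_stmt s -> wf_stmt (subst x v s).
Proof.
elim: s => //= [y e s IH|s IHs t IHt|q y e s IH|s IHs t IHt].
- by move=> wf; case/and3P: (wf) => /subst_under_binder->.
- by case/andP=> /IHs-> /IHt->.
- by move=> wf; case/and3P: (wf) => /subst_under_binder->.
- by case/andP=> /IHs-> /IHt->.
Qed.

Lemma eocc_esubst x v e :
  {subset eocc (esubst x v e) <= v :: eocc e}.
Proof.
elim/expr_nested_ind: e => //= [w|y|fes IH] u.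
- by rewrite !inE => ->; rewrite orbT.
- by case: eqP.
- elim: fes IH => //= -[f e] fes IHfes /= [IHe IH]; rewrite !(inE, mem_cat).
  case/orP=> [/IHe|/(IHfes IH)]; rewrite inE => /orP[]->; rewrite ?orbT //.
Qed.

Lemma occ_subst x v p s : wf_stmt s -> static s ->
  {subset occ p (subst x v s) <= (p, v) :: occ p s}.
Proof.
have emap p0 e : {subset [seq (p0, w) | w <- eocc (esubst x v e)]
                  <= (p0, v) :: [seq (p0, w) | w <- eocc e]}.
  move=> _ /mapP[w /eocc_esubst w_in ->].
  by rewrite -[_ :: _]/[seq (p0, w) | w <- v :: eocc e] map_f.
elim: s p => //= [c|y e s IH|e f e'|s IHs t IHt|q y e s IH|mu s IH|s IHs t IHt] p.
- by move=> _ _ u; rewrite !inE => ->; rewrite orbT.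
- case/and3P=> /subst_under_binder-> _ _ _ u; rewrite !(inE, mem_cat).
  by case/orP=> [/emap|->]; rewrite ?inE ?orbT // => /orP[]->; rewrite ?orbT.
- move=> _ _ u; rewrite !(inE, map_cat, mem_cat).
  by case/orP=> /emap; rewrite inE => /orP[]->; rewrite ?orbT.
- case/andP=> ws wt /andP[ss st] u; rewrite !(inE, mem_cat).
  case/orP=> [/(IHs _ ws ss)|/(IHt _ wt st)]; rewrite inE => /orP[]->;
    by rewrite ?orbT.
- case/and3P=> /subst_under_binder-> _ _ _ u; rewrite !(inE, mem_cat).
  by case/orP=> [/emap|->]; rewrite ?inE ?orbT // => /orP[]->; rewrite ?orbT.
- by move=> ws /andP[_]; apply: IH.
- case/andP=> ws wt /andP[ss st] u; rewrite !(inE, mem_cat).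
  case/orP=> [/(IHs _ ws ss)|/(IHt _ wt st)]; rewrite inE => /orP[]->;
    by rewrite ?orbT.
Qed.

(** * Good values, heaps and statements *)

Definition val_ok g q v : Prop :=
  match v with
  | VLoc o => forall h, g.[? q] = Some h -> o \in domf h
  | VGlob r => gref_resolved g r
  | VExn _ => True
  end.

(** Single fields are constrained in place of the paths of [heap_place_local], which makes the
    condition easy to check after an update. *)
Definition heap_ok g : Prop := forall q h, g.[? q] = Some h ->
  (forall o, o \in domf h -> home o = q) /\
  (forall o (ob : obj) f v,
     h.[? o] = Some ob -> ob.[? f] = Some v -> val_ok g q v).

Definition expr_ok g p e : Prop := {in eocc e, forall v, val_ok g p v}.

Definition stmt_ok g p s : Prop :=
  {in occ p s, forall qv, val_ok g qv.1 qv.2}.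

(* From g to g', places may fail and surviving local heaps may grow. *)
Definition heap_le g g' : Prop := forall q h', g'.[? q] = Some h' ->
  exists2 h, g.[? q] = Some h & {subset domf h <= domf h'}.

Lemma heap_le_refl g : heap_le g g.
Proof. by move=> q h gq; exists h. Qed.

Lemma val_ok_le g g' q v : heap_le g g' -> val_ok g q v -> val_ok g' q v.
Proof.
move=> gg'; case: v => //= [o|r] ok h' /gg'[h gq]; apply; exact: (ok h gq).
Qed.

Lemma expr_ok_le g g' p e : heap_le g g' -> expr_ok g p e -> expr_ok g' p e.
Proof. by move=> gg' ok v /ok; apply: val_ok_le. Qed.

Lemma stmt_ok_le g g' p s : heap_le g g' -> stmt_ok g p s -> stmt_ok g' p s.
Proof. by move=> gg' ok qv /ok; apply: val_ok_le. Qed.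

(** Translates between the notions of the theorem and the invariant kept by steps. Forwards, a field
    is a path of length one; backwards, only the last link of a path counts, since every allocated
    object has good fields. *)
Lemma place_localP p s g :
  place_local p s g /\ grefs_resolved p s g <-> heap_ok g /\ stmt_ok g p s.
Proof.
split=> [[[locg locs] [ress resg]]|[okg oks]].
  split=> [q h gq|[q [o|r|//]] /= qv]; first last.
  - exact: ress qv.
  - by move=> h gq; apply: locs gq qv.
  - have [homeh reachh] := locg q h gq; split=> // o ob f [o'|r|//] ho obf.
      have o_in : o \in domf h by rewrite -fndSome ho.
      have /(reachh o _ o_in)[_ o'_in] := reach_field (reach_root h o) ho obf.
      by move=> h1 /=; rewrite gq => -[<-].
    exact: resg gq ho obf.
split; split.
- move=> q h gq; have [homeh okh] := okg q h gq; split=> // o v o_in.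
  elim=> [|o1 ob f [o'|r|//] _ _ ho obf]; first by split=> //; apply: homeh.
    have o'_in : o' \in domf h := okh _ _ _ _ ho obf h gq.
    by split=> //; apply: homeh.
  exact: valP r.
- by move=> q h o gq /oks /= ok; apply: ok gq.
- by move=> q r /oks.
- by move=> q h o ob f r gq ho obf; have [_ /(_ _ _ _ _ ho obf)] := okg q h gq.
Qed.

(** * Heap updates and place failure *)

Lemma heap_le_set g p h h' :
  g.[? p] = Some h -> {subset domf h <= domf h'} -> heap_le g g.[p <- h'].
Proof.
move=> gp hh' q h1; rewrite fnd_set; case: eqP => [-> [<-]|_ gq].
  by exists h.
by exists h1.
Qed.

(** Goodness of the fields is asked in the updated heap, since a copied object may refer to ids
    allocated together with it. *)
Lemma heap_ok_set g p h h' :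
  heap_ok g -> g.[? p] = Some h -> {subset domf h <= domf h'} ->
  (forall o, o \in domf h' -> home o = p) ->
  (forall o (ob : obj) f v, h'.[? o] = Some ob -> ob.[? f] = Some v ->
     val_ok g.[p <- h'] p v) ->
  heap_ok g.[p <- h'].
Proof.
move=> okg gp hh' homeh' okh' q h1; rewrite fnd_set; case: eqP => [-> [<-]|_ gq].
  by split.
have [homeh1 okh1] := okg q h1 gq; split=> // o ob f v ho obf.
by apply: val_ok_le (heap_le_set gp hh') _; apply: okh1 ho obf.
Qed.

(** An expression step that leaves the local heap alone still writes it back at [p]. *)
Lemma heap_set_id g p h : g.[? p] = Some h -> g.[p <- h] = g.
Proof. by move=> gp; apply/fmapP => q; rewrite fnd_set; case: eqP => // ->. Qed.

Lemma heap_le_rem g p : heap_le g g.[~ p].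
Proof.
by move=> q h; rewrite fnd_rem1; case: ifP => // _ gq; exists h.
Qed.

Lemma heap_ok_rem g p : heap_ok g -> heap_ok g.[~ p].
Proof.
move=> okg q h; rewrite fnd_rem1; case: ifP => // _ /okg[homeh okh].
split=> // o ob f v ho obf; apply: val_ok_le (heap_le_rem (p := p)) _.
exact: okh ho obf.
Qed.

(** * Steps of expressions *)

Lemma mkobj_get (fvs : seq (fname * value)) f v :
  (mkobj fvs).[? f] = Some v -> v \in [seq fv.2 | fv <- fvs].
Proof.
elim: fvs => [|[f1 v1] fvs IH] /=; first by rewrite fnd_fmap0.
rewrite fnd_set inE; case: eqP => [_ [->]|_ /IH->]; rewrite ?eqxx ?orbT //.
Qed.

Lemma eocc_vals (fvs : seq (fname * value)) :
  flatten [seq eocc fe.2 | fe <- [seq (fv.1, EVal fname var fv.2) | fv <- fvs]]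
    = [seq fv.2 | fv <- fvs].
Proof. by elim: fvs => //= fv fvs ->. Qed.

Definition econf_heap (c : econf home fname var) : lheap :=
  match c with ERun _ h | EDone h => h end.

Lemma econf_heap_map K c : econf_heap (map_econf K c) = econf_heap c.
Proof. by case: c. Qed.

Lemma estep_ok p e h l c g : estep p e h l c ->
  g.[? p] = Some h -> heap_ok g -> expr_ok g p e ->
  let g' := g.[p <- econf_heap c] in
  [/\ heap_le g g', heap_ok g' &
      if c is ERun e' _ then expr_ok g' p e' else True].
Proof.
move=> st gp okg; elim: st gp => {e h l c}
  [fvs h o homeo oN|o ob f v h ho obf|o ob f h _ _|o r h r_op|o r h r_op|v h _
  |e f h l c st IH|e h l c st IH|e h l c st IH|fvs f e fes h l c st IH K] gp oke;
  rewrite ?econf_heap_map /=.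
- have hh' : {subset domf h <= domf h.[o <- mkobj fvs]}.
    by move=> o1 o1_in; rewrite mem_setf inE o1_in orbT.
  have le := heap_le_set gp hh'.
  split=> //.
    apply: (heap_ok_set okg gp hh') => [o1|o1 ob f v].
      rewrite mem_setf !inE => /orP[/eqP->//|o1_in].
      by have [homeh _] := okg _ _ gp; apply: homeh.
    rewrite fnd_set; case: eqP => [_ [<-] /mkobj_get v_in|_ ho obf];
      apply: val_ok_le le _.
      by apply: oke; rewrite /= eocc_vals.
    by have [_ okh] := okg _ _ gp; apply: okh ho obf.
  move=> v; rewrite inE => /eqP-> h1 /=.
  by rewrite fnd_set eqxx => -[<-]; rewrite mem_setf !inE eqxx.
- rewrite heap_set_id //; split=> //; first exact: heap_le_refl.
  move=> w; rewrite inE => /eqP->.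
  by have [_ okh] := okg _ _ gp; apply: okh ho obf.
- by rewrite heap_set_id //; split=> //; apply: heap_le_refl.
- rewrite heap_set_id //; split=> //; first exact: heap_le_refl.
  move=> w; rewrite inE => /eqP-> /= h1; rewrite r_op /= => gp1.
  by have /(_ _ gp1) := oke (VLoc home o) (mem_head _ _).
- rewrite heap_set_id //; split=> //; first exact: heap_le_refl.
  move=> w; rewrite inE => /eqP-> /= h1 gp1.
  (* The reference is resolved and its place is [p], so its id is allocated at [p]. A dangling
     reference would break this case. *)
  by have := oke (VGlob r) (mem_head _ _) h1; rewrite r_op; apply.
- by rewrite heap_set_id //; split=> //; apply: heap_le_refl.
- by case: (IH gp oke) => le ok okc; split=> //; case: c {st IH le ok} okc.
- by case: (IH gp oke) => le ok okc; split=> //; case: c {st IH le ok} okc.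
- by case: (IH gp oke) => le ok okc; split=> //; case: c {st IH le ok} okc.
- have occK e1 v : v \in eocc (K e1) =
      [|| v \in [seq fv.2 | fv <- fvs], v \in eocc e1 |
          v \in flatten [seq eocc fe.2 | fe <- fes]].
    by rewrite /= map_cat flatten_cat mem_cat eocc_vals /= mem_cat.
  have oke1 : expr_ok g p e by move=> v v_in; apply: oke; rewrite occK v_in orbT.
  have [le ok okc] := IH gp oke1; split=> //.
  case: c {st IH} le ok okc => //= e' h' le ok oke' v; rewrite occK => v_in.
  (* Outside the field under evaluation the literal is unchanged, so goodness carries over from
     [g]. *)
  have [/oke'//|v_eN] := boolP (v \in eocc e').
  apply: val_ok_le le _; apply: oke; rewrite occK.
  by case/or3P: v_in v_eN => -> //; rewrite ?orbT.
Qed.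

(** * Copying an object graph to another place *)

Lemma copy_ok p q g v v' g' :
  copy q g v v' g' -> p \in domf g -> heap_ok g -> val_ok g p v ->
  [/\ heap_le g g', heap_ok g' & val_ok g' q v'].
Proof.
case=> {v v' g'} [o h0 h h' phi gh0 gq R injR freshR _ h'phi h'old|r|c] pg okg /=;
  [move=> okv | by split=> //; apply: heap_le_refl..].
(* [copy] reads the graph at the home of [o]; as [o] is allocated at the surviving place [p], this
   home is [p]. *)
have homeo : home o = p.
  by have [homeh _] := okg _ _ (in_fnd pg); apply/homeh/(okv _ (in_fnd pg)).
have [homeh0 okh0] := okg _ _ gh0.
have R_in r : R r -> r \in domf h0.
  (* [reach] is indexed by arbitrary values, so the claim is extended trivially to the non-local
     ones before the elimination. *)
  have reach_ok w : reach h0 o w -> if w is VLoc r then r \in domf h0 else true.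
    elim=> [|o1 ob f [o2|//|//] _ _ ho obf] //.
      by apply: okv; rewrite -homeo.
    by have := okh0 _ _ _ _ ho obf; apply.
  exact: reach_ok.
have phi_in r : R r -> phi r \in domf h'.
  by move=> Rr; rewrite -fndSome h'phi // in_fnd ?R_in.
have hh' : {subset domf h <= domf h'}.
  move=> i i_in; rewrite -fndSome h'old ?fndSome // => r /freshR[_ /negP phiN] ri.
  by rewrite ri in phiN.
have le := heap_le_set gq hh'.
have [homeh okh] := okg _ _ gq.
have is_new i : (exists2 r, R r & phi r = i) \/ h'.[? i] = h.[? i].
  (* Reachability is a bare proposition, so excluded middle decides whether [i] is the id of a
     copied object. *)
  have [|noR] := classic (exists2 r, R r & phi r = i); first by left.
  by right; apply: h'old => r Rr ri; apply: noR; exists r.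
split=> //; last by move=> h1; rewrite fnd_set eqxx => -[<-]; apply: phi_in; left.
apply: (heap_ok_set okg gq hh') => [i|i ob f w].
  have [[r Rr <-] _|hi] := is_new i; first by case: (freshR r Rr).
  by rewrite -fndSome hi fndSome; apply: homeh.
have [[r Rr <-]|->] := is_new i; last first.
  by move=> hi obf; apply: val_ok_le le _; apply: okh hi obf.
rewrite h'phi //; case h0r: h0.[? r] => [ob0|//] [<-].
case: fndP => // f_in [<-]; rewrite ffunE.
have ob0f : ob0.[? f] = Some ob0.[f_in] by rewrite in_fnd.
have := okh0 _ _ _ _ h0r ob0f.
case: ob0.[f_in] ob0f => //= [o1 ob0f _|r1 _]; last first.
  (* Goodness of a global reference does not depend on where it occurs, so it passes from the source
     place to [q]. *)
  exact: (@val_ok_le _ _ q (VGlob r1) le).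
(* A local field of a reachable object is reachable too, so its renamed id belongs to the copy. *)
move=> h1; rewrite fnd_set eqxx => -[<-]; apply: phi_in.
exact: reach_field Rr h0r ob0f.
Qed.

(** * Steps of statements *)

Lemma stmt_ok_cat g p s t : stmt_ok g p (SSeq s t) <-> stmt_ok g p s /\ stmt_ok g p t.
Proof.
split=> [ok|[oks okt] qv]; last by rewrite mem_cat => /orP[/oks|/okt].
by split=> qv qv_in; apply: ok; rewrite /= mem_cat qv_in ?orbT.
Qed.

(** The hole of each context lies at the executing place, even in [SAt]; [vs] collects the rest.
    Equality is up to order because the hole may be on the right of an assignment. *)
Lemma ctx_occ (K : expr -> stmt) p : ctx K ->
  exists vs, forall e, occ p (K e) =i [seq (p, v) | v <- eocc e] ++ vs.
Proof.
case=> [x s|f e1|o f|q x s].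
- by exists (occ p s).
- by exists [seq (p, v) | v <- eocc e1] => e qv; rewrite /= map_cat.
- by exists [:: (p, VLoc home o)] => e qv; rewrite /= !(inE, mem_cat) orbC.
- by exists (occ q s).
Qed.

Lemma ctx_wf (K : expr -> stmt) e e' : ctx K -> wf_stmt (K e) = wf_stmt (K e').
Proof. by case. Qed.

Definition conf_heap (c : conf home fname var) : gheap :=
  match c with Run _ g | Done g => g end.

Definition conf_ok p (c : conf home fname var) : Prop :=
  if c is Run s g then wf_stmt s /\ stmt_ok g p s else True.

(** The [heap_le] component lets the part of a compound statement that does not move stay good while
    the other part steps. *)
Lemma step_ok p s g l c : step p s g l c ->
  wf_stmt s -> heap_ok g -> stmt_ok g p s ->
  [/\ heap_le g (conf_heap c), heap_ok (conf_heap c) & conf_ok p c].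
Proof.
have le_refl := heap_le_refl.
elim=> {p s g l c}.
- by split.
- by split.
- move=> p x v s g l c _ _ IH /and3P[fvs st wf] okg oks.
  apply: IH => //; first exact: wf_subst.
  (* By conversion, [(p, v) :: occ p s] lists the occurrences before the substitution. *)
  by move=> qv /(occ_subst wf st) ; apply: oks.
- move=> p o f v g h ob gp ho f_in _ okg oks.
  have [homeh okh] := okg _ _ gp.
  have o_in : o \in domf h by rewrite -fndSome ho.
  have hh' : {subset domf h <= domf h.[o <- ob.[f <- v]]}.
    by move=> o1 o1_in; rewrite mem_setf inE o1_in orbT.
  have le := heap_le_set gp hh'; split=> //=.
  apply: (heap_ok_set okg gp hh') => [o1|o1 ob1 f1 v1].
    by rewrite mem_setf inE => /orP[/eqP->|]; apply: homeh.
  rewrite fnd_set; case: eqP => [_ [<-]|_ ho1 obf].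
    rewrite fnd_set; case: eqP => [_ [<-]|_ obf]; apply: val_ok_le le _.
      by apply: (oks (p, v)); rewrite !inE eqxx orbT.
    exact: okh ho obf.
  by apply: val_ok_le le _; apply: okh ho1 obf.
- by split.
- move=> p K e g h l c ctxK gp st wf okg oks.
  have [vs occK] := ctx_occ p ctxK.
  have oke : expr_ok g p e.
    by move=> v v_in; apply: (oks (p, v)); rewrite occK mem_cat map_f.
  have [] := estep_ok st gp okg oke.
  case: c {st} => [e' h'|h'] //= le ok oke'; split=> //; split.
    by rewrite (ctx_wf _ e).
  move=> qv; rewrite occK mem_cat => /orP[/mapP[v /oke' ? ->]//|qv_in].
  by apply: val_ok_le le _; apply: oks; rewrite occK mem_cat qv_in orbT.
- move=> p s g _ _ wf okg oks; have le := heap_le_rem (g := g) (p := p).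
  by split=> //; [apply: heap_ok_rem|split=> //; apply: stmt_ok_le oks].
- by split.
- by split.
- by split.
(* [SAsyncD] and [SFinish] change neither place, occurrences nor well-formedness, so the induction
   hypothesis is the goal by conversion. *)
- by move=> p s g l [s' g'|g'] _ IH.
- by move=> p mu s g l s' g' _ IH.
- by move=> p mu s g l g' _ IH.
- move=> p s t g l s' g' _ IH _ /= /andP[ws wt] okg /stmt_ok_cat[oks okt].
  have [le ok [ws' oks']] := IH ws okg oks; split=> //=; split; first exact/andP.
  by apply/stmt_ok_cat; split=> //; apply: stmt_ok_le okt.
- by move=> p s t g v s' g' _ IH /= /andP[ws wt] okg /stmt_ok_cat[oks okt]; apply: IH.
- move=> p s t g l c _ _ IH /= /andP[wt ws] okg /stmt_ok_cat[okt oks].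
  have [] := IH ws okg oks; case: c {IH} => [s' g'|g'] /= le ok okc.
    case: okc => ws' oks'; split=> //; split; first exact/andP.
    by apply/stmt_ok_cat; split=> //; apply: stmt_ok_le okt.
  by split=> //; split=> //; apply: stmt_ok_le okt.
- move=> p s t g l g' _ _ IH _ /= /andP[ws wt] okg /stmt_ok_cat[oks okt].
  by have [le ok _] := IH ws okg oks; split=> //; split=> //; apply: stmt_ok_le okt.
- by move=> p s t g v g' _ _ IH /= /andP[ws wt] okg /stmt_ok_cat[oks okt]; apply: IH.
- by move=> p s t g l g' _ _ IH _ /= /andP[ws wt] okg /stmt_ok_cat[oks okt]; apply: IH.
- move=> p s t g l g' _ _ IH _ /= /andP[ws wt] okg /stmt_ok_cat[oks okt].
  by have [le ok _] := IH ws okg oks; split=> //; split=> //; apply: stmt_ok_le okt.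
- move=> p q x v s g v' g' pg qg cp /= /and3P[fvs st wf] okg oks.
  have okv : val_ok g p v by apply: (oks (p, v)); rewrite inE eqxx.
  have [le ok okv'] := copy_ok cp pg okg okv; split=> //=.
  split; first by rewrite wf_subst.
  (* An occurrence is either the copied value, now good at [q], or one of the original body, which
     [SAt] already located at [q]. *)
  move=> qv; rewrite /= cats0 => /(occ_subst wf st); rewrite inE => /orP[/eqP->//|qv_in].
  by apply: val_ok_le le _; apply: oks; rewrite /= inE qv_in orbT.
- by split.
(* The body both runs and has its occurrences counted at [q], whatever [p] is. *)
- by move=> p q s g l [s' g'|g'] _ IH.
- move=> p s t g l c _ IH _ /= /andP[ws wt] okg /stmt_ok_cat[oks okt].
  have [] := IH ws okg oks; case: c {IH} => [s' g'|g'] //= le ok [ws' oks'].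
  split=> //; split; first exact/andP.
  (* [occ] treats [STry] exactly as [SSeq]. *)
  by apply/(@stmt_ok_cat _ _ s' t); split=> //; apply: stmt_ok_le okt.
- move=> p s t g v c _ _ IH /= /andP[ws wt] okg /stmt_ok_cat[oks okt].
  have [] := IH ws okg oks; case: c {IH} => [s' g'|g'] /= le ok okc.
    case: okc => ws' oks'; split=> //; split; first exact/andP.
    by apply/stmt_ok_cat; split=> //; apply: stmt_ok_le okt.
  by split=> //; split=> //; apply: stmt_ok_le okt.
- by move=> p s t g c _ _ IH /= /andP[ws wt] okg /stmt_ok_cat[oks okt]; apply: IH.
Qed.

End PlaceLocality.

Theorem proposition4p4 (n : nat) (home : objid -> 'I_n) (fname : choiceType)
    (var : eqType) (p : 'I_n) (s : stmt home fname var)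
    (g : gheap home fname) (l : label) (c : conf home fname var) :
  wf_stmt s -> grefs_resolved p s g -> place_local p s g ->
  step p s g l c ->
  match c with
  | Run s' g' => [/\ wf_stmt s', grefs_resolved p s' g' & place_local p s' g']
  | Done g' => heap_place_local g'
  end.
Proof.
move=> wf res loc st.
have [okg oks] := (place_localP p s g).1 (conj loc res).
have [_] := step_ok st wf okg oks; case: c {st} => [s' g'|g'] /= okg'.
  by case=> wf' oks'; have [] := (place_localP p s' g').2 (conj okg' oks').
(* A terminated configuration has no statement; [SSkip], in which no value occurs, stands in for it
   in the equivalence. *)
have skip_ok : stmt_ok g' p (SSkip home fname var) by [].
by have [[]] := (place_localP p _ g').2 (conj okg' skip_ok).
Qed.
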